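(* Let $R$ be a $G$-graded commutative ring, $M$ a $G$-graded $R$-module, and $s\in h^*(R)$. If $N\in GSpec_s({}_RM)$, then $(N:_RM)\in GSpec_s(R)$.
   Context: $G$ is a group with identity $e$; rings are commutative with nonzero unity $1$ and modules are unital. A ring $R$ is $G$-graded if $R=\bigoplus_{g\in G}R_g$ with additive subgroups $R_g$ satisfying $R_gR_h\subseteq R_{gh}$; $h(R)=\bigcup_{g\in G}R_g$ and $h^*(R)=h(R)\setminus\{0\}$. An $R$-module $M$ is $G$-graded if $M=\bigoplus_{g\in G}M_g$ with additive subgroups $M_g$ satisfying $R_gM_h\subseteq M_{gh}$; $h(M)=\bigcup_{g\in G}M_g$. A submodule $N$ of $M$ is graded if $N=\bigoplus_{g\in G}(N\cap M_g)$; graded ideals of $R$ are the graded submodules of $R$. Write $(N:_RM)=\{r\in R: rM\subseteq N\}$. For $s\in h^*(R)$, a graded $R$-submodule $N$ of $M$ is graded $s$-prime if $s\notin(N:_RM)$ and, for all $r\in h(R)$ and $m\in h(M)$, $rm\in N$ implies $sr\in(N:_RM)$ or $sm\in N$. $GSpec_s({}_RM)$ is the set of graded $s$-prime $R$-submodules of $M$, and $GSpec_s(R)$ is the set of graded $s$-prime ideals of $R$ (graded ideals that are graded $s$-prime submodules of the $R$-module $R$). *)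

(* Defs.v *)
From HB Require Import structures.
From mathcomp Require Import all_boot all_algebra.
From mathcomp Require Import boolp classical_sets functions cardinality fsbigop.

Set Implicit Arguments.
Unset Strict Implicit.
Unset Printing Implicit Defensive.

Import GRing.Theory.
Local Open Scope ring_scope.
Local Open Scope classical_set_scope.

(* [G] is an arbitrary group, written multiplicatively: possibly infinite and
   non-commutative. Subsets of rings and modules are Prop-valued [set]s. *)

Definition decomposes (G : groupType) (V : zmodType) (B : G -> set V)
    (f : G -> V) (x : V) : Prop :=
  [/\ forall g, B g (f g),
      finite_set (f @^-1` [set~ 0]) &
      x = \sum_(g \in [set: G]) f g].

(* [S] is the internal direct sum of the additive subgroups [B g]. *)
Definition direct_sum (G : groupType) (V : zmodType) (S : set V)
    (B : G -> set V) : Prop :=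
  [/\ forall g, GRing.zmod_closed (mem (B g)),
      S = [set x | exists f, decomposes B f x] &
      forall f f' x, decomposes B f x -> decomposes B f' x -> f = f'].

Definition graded_ring (G : groupType) (R : comNzRingType)
    (Rg : G -> set R) : Prop :=
  direct_sum [set: R] Rg /\
  forall (g h : G) (a b : R), Rg g a -> Rg h b -> Rg (g * h)%g (a * b).

Definition graded_module (G : groupType) (R : comNzRingType) (Rg : G -> set R)
    (M : lmodType R) (Mg : G -> set M) : Prop :=
  direct_sum [set: M] Mg /\
  forall (g h : G) (a : R) (m : M), Rg g a -> Mg h m -> Mg (g * h)%g (a *: m).

Definition homogeneous (G : groupType) (V : zmodType) (Vg : G -> set V)
  : set V := \bigcup_(g in [set: G]) Vg g.

Definition homogeneous_nz (G : groupType) (V : zmodType) (Vg : G -> set V)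
  : set V := homogeneous Vg `\ 0.

Definition graded_submodule (G : groupType) (R : comNzRingType)
    (M : lmodType R) (Mg : G -> set M) (N : set M) : Prop :=
  GRing.submod_closed (mem N) /\ direct_sum N (fun g => N `&` Mg g).

(* The residual (N :_R M). *)
Definition colon (R : comNzRingType) (M : lmodType R) (N : set M) : set R :=
  [set r | forall m : M, N (r *: m)].

Definition graded_s_prime (G : groupType) (R : comNzRingType)
    (Rg : G -> set R) (M : lmodType R) (Mg : G -> set M) (s : R)
    (N : set M) : Prop :=
  [/\ graded_submodule Mg N,
      ~ colon N s &
      forall (r : R) (m : M), homogeneous Rg r -> homogeneous Mg m ->
        N (r *: m) -> colon N (s * r) \/ N (s *: m)].

Definition GSpec (G : groupType) (R : comNzRingType) (Rg : G -> set R)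
    (M : lmodType R) (Mg : G -> set M) (s : R) : set (set M) :=
  [set N | graded_s_prime Rg Mg s N].

(* Ideals of [R] are the submodules of the regular module [R^o]. *)
Definition GSpec_ring (G : groupType) (R : comNzRingType) (Rg : G -> set R)
    (s : R) : set (set R) :=
  GSpec (M := R^o) Rg Rg s.

(* Main.v *)
(** The graded part is the only delicate point: if [r = \sum_g r_g] lies in
    [(N : M)] and [m] is homogeneous of degree [h], then the [r_g m] have the
    pairwise distinct degrees [g h], so they are the homogeneous components of
    [r m] in [N], and [N], being graded, contains each of them. For primality,
    if [r t M] lies in [N] then primality of [N] is applied to [r] and [t m],
    for [m] homogeneous. *)
Require Import Defs.
From HB Require Import structures.
From mathcomp Require Import all_boot all_algebra finmap.
From mathcomp Require Import boolp classical_sets functions cardinality fsbigop.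

Set Implicit Arguments.
Unset Strict Implicit.
Unset Printing Implicit Defensive.

Import GRing.Theory.
Local Open Scope ring_scope.
Local Open Scope classical_set_scope.

Lemma decomposes_sub (G : groupType) (V : zmodType) (B C : G -> set V)
    (f : G -> V) (x : V) :
  (forall g, C g (f g)) -> decomposes B f x -> decomposes C f x.
Proof. by move=> Cf [_ fin xE]; split. Qed.

Lemma decomposes_ind (G : groupType) (V : zmodType) (B : G -> set V)
    (P : V -> Prop) (f : G -> V) (x : V) :
  P 0 -> (forall u v, P u -> P v -> P (u + v)) -> (forall g, P (f g)) ->
  decomposes B f x -> P x.
Proof. by move=> P0 PD Pf [_ _ ->]; apply: big_ind. Qed.

(** An additive map that moves degrees by a bijection carries components to components. It is meant
    for [a |-> a *: m] with [m] of degree [h], which moves degrees by right translation by [h]. *)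
Lemma decomposes_morph (G : groupType) (V W : zmodType) (B : G -> set V)
    (C : G -> set W) (phi : V -> W) (h h' : G -> G) (f : G -> V) (x : V) :
  {morph phi : u v / u + v} -> phi 0 = 0 -> cancel h h' -> cancel h' h ->
  (forall g v, B g v -> C (h g) (phi v)) ->
  decomposes B f x -> decomposes C (fun g => phi (f (h' g))) (phi x).
Proof.
move=> phiD phi0 hK h'K BC [Bf fin ->]; split.
- by move=> g; rewrite -{1}(h'K g); exact: BC.
- apply: sub_finite_set (finite_image h fin) => g /= phif.
  exists (h' g); last exact: h'K.
  by move=> /= f0; apply: phif; rewrite f0.
(* After reindexing, both sums reduce to the finite support of [f], where additivity of [phi]
   applies. *)
- rewrite [RHS](reindex_fsbigT h); last by exists h'.
  under [RHS]eq_fsbigr do rewrite hK.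
  have f0 g : g \notin fset_set (f @^-1` [set~ 0]) -> f g = 0.
    by rewrite in_fset_set// notin_setE /= => /contrapT.
  rewrite (fsbigTE _ _ f0) (fsbigTE (fset_set (f @^-1` [set~ 0])))//.
    exact: big_morph.
  by move=> g /f0 ->.
Qed.

Section Submodules.
Variables (R : comNzRingType) (M : lmodType R) (N : set M).
Hypothesis Nsub : GRing.submod_closed (mem N).

Lemma submod_closed_0 : N 0.
Proof. by case: Nsub => + _; rewrite inE. Qed.

Lemma submod_closed_linear a u v : N u -> N v -> N (a *: u + v).
Proof.
case: Nsub => _ Nl Nu Nv.
by have := Nl a u v (mem_set Nu) (mem_set Nv); rewrite inE.
Qed.

Lemma submod_closed_add u v : N u -> N v -> N (u + v).
Proof. by rewrite -{2}[u]scale1r; exact: submod_closed_linear. Qed.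

Lemma colon_submod_closed : GRing.submod_closed (V := R^o) (mem (colon N)).
Proof.
split=> [|a u v]; rewrite !inE.
  by move=> m; rewrite scale0r; exact: submod_closed_0.
move=> Nu Nv m.
by rewrite scalerDl -scalerA; exact: submod_closed_linear.
Qed.

End Submodules.

Section Graded.
Variables (G : groupType) (R : comNzRingType) (Rg : G -> set R).
Variables (M : lmodType R) (Mg : G -> set M) (N : set M).
Hypotheses (Rgr : graded_ring Rg) (Mgr : graded_module Rg Mg).
Hypothesis Nsub : GRing.submod_closed (mem N).

(** Each [m] is a finite sum of homogeneous elements and [r *: _] is additive. This lets both
    gradedness and primality be tested on homogeneous [m] only. *)
Lemma colon_homogeneous (r : R) :
  (forall m, homogeneous Mg m -> N (r *: m)) -> colon N r.
Proof.
move=> Nr m; case: Mgr => -[_ /seteqP[+ _] _] _.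
move=> /(_ m I)[f fm]; have [Mf _ _] := fm.
apply: (decomposes_ind (P := fun x => N (r *: x)) _ _ _ fm).
- by rewrite scaler0; exact: submod_closed_0.
- by move=> u v Nu Nv; rewrite scalerDr; exact: submod_closed_add.
- by move=> g; apply: Nr; exists g.
Qed.

Lemma colon_component (f : G -> R) (r : R) (g : G) :
  graded_submodule Mg N -> decomposes Rg f r -> colon N r -> colon N (f g).
Proof.
move=> [_ [_ /seteqP[Ndec _] _]] fr Nr.
apply: colon_homogeneous => m [h _ Mm].
have [e em] := Ndec _ (Nr m); have [Ne _ _] := em.
have [[_ _ Muniq] RM] := Mgr.
have eM : decomposes Mg e (r *: m).
  by apply: decomposes_sub em => k; case: (Ne k).
have fm := decomposes_morph (phi := fun a => a *: m)
  (fun a b => scalerDl m a b) (scale0r m) (mulgK h) (mulgVK h)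
  (fun k a Ra => RM k h a m Ra Mm) fr.
(* Two decompositions of [r *: m] in [M] must agree: [fm], from the components of [r], and [eM],
   from those in [N]. In degree [g * h] the former has [f g *: m]. *)
have /(congr1 (fun u => u (g * h)%g)) := Muniq _ _ _ fm eM.
by rewrite /= mulgK => ->; case: (Ne (g * h)%g).
Qed.

Lemma colon_graded :
  graded_submodule Mg N -> graded_submodule (M := R^o) Rg (colon N).
Proof.
move=> Ngr; have cN := colon_submod_closed Nsub; split=> //.
have [[Rz Rdec Runiq] _] := Rgr; split.
- move=> g; have [R0 RB] := Rz g; have [c0 _] := cN.
  have cB := GRing.submod_closedB cN.
  split; first by rewrite !inE in R0 c0 *.
  move=> u v; rewrite !inE => -[cu Ru] [cv Rv]; split.
    by have := cB.2 u v (mem_set cu) (mem_set cv); rewrite inE.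
  by have := RB u v (mem_set Ru) (mem_set Rv); rewrite inE.
- apply/seteqP; split=> [r cr|r [f fr]].
    have /seteqP[/(_ r I)[f fr] _] := Rdec; exists f.
    have [Rf _ _] := fr.
    apply: (decomposes_sub _ fr) => g; split=> //; exact: colon_component fr cr.
  have [cf _ _] := fr.
  apply: (decomposes_ind _ _ _ fr).
  + exact: (submod_closed_0 cN).
  + exact: (submod_closed_add cN).
  + by move=> g; case: (cf g).
(* Uniqueness is inherited from the grading of [R]. *)
- move=> f f' x fx f'x; have [cf _ _] := fx; have [cf' _ _] := f'x.
  apply: (Runiq _ _ x).
    by apply: decomposes_sub fx => g; case: (cf g).
  by apply: decomposes_sub f'x => g; case: (cf' g).
Qed.

End Graded.

Theorem proposition2p6 (G : groupType) (R : comNzRingType) (Rg : G -> set R)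
    (M : lmodType R) (Mg : G -> set M) (s : R) (N : set M) :
  graded_ring Rg ->
  graded_module Rg Mg ->
  homogeneous_nz Rg s ->
  GSpec Rg Mg s N ->
  GSpec_ring Rg s (colon N).
Proof.
move=> Rgr Mgr _ [Ngr Ns Nprime]; have [Nsub _] := Ngr.
split.
- exact: (colon_graded Rgr Mgr Nsub Ngr).
(* Evaluating at the unity of [R] would put [s] itself in [colon N]. *)
- by move=> /(_ 1); rewrite [_ *: _]mulr1.
- move=> r t Rr [g _ Rt] crt.
  (* The first alternative in the primality of [N] does not depend on [m], so it is decided before
     [m] is chosen; if it fails, the second holds for every homogeneous [m]. *)
  have [csr|Ncsr] := pselect (colon N (s * r)); [left|right].
    by move=> a m; rewrite -[_ *: a]/(s * r * a) -scalerA; exact: csr.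
  apply: (colon_homogeneous Mgr Nsub) => m [h _ Mm].
  have tm : homogeneous Mg (t *: m).
    by exists (g * h)%g => //; exact: Mgr.2.
  have [|//|] := Nprime r (t *: m) Rr tm.
    by rewrite scalerA; exact: crt.
  by rewrite scalerA.
Qed.
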